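(* For all integers $m,n\ge 1$, the independence polynomial $I_{T^*_{3,m,n}}(t)$ of the tree $T^*_{3,m,n}$ is unimodal.
   Context: For a finite simple graph $G$, let $i_k$ be the number of independent sets of $G$ of size $k$ ($i_0=1$), and $I_G(t)=\sum_{k\ge 0} i_k t^k$ its independence polynomial. A polynomial is unimodal if its coefficient sequence $a_0,\dots,a_N$ satisfies $a_0\le\cdots\le a_j\ge a_{j+1}\ge\cdots\ge a_N$ for some $j$. The tree $T_{3,m,n}$ has a root $v_0$ with three children $v_1,v_2,v_3$; $v_1$ has children $v_{11},v_{12},v_{13}$, $v_2$ has children $v_{21},\dots,v_{2m}$, $v_3$ has children $v_{31},\dots,v_{3n}$, and each $v_{ij}$ has exactly one child $v'_{ij}$ (a leaf). The tree $T^*_{3,m,n}$ is obtained from $T_{3,m,n}$ by adding two new vertices $x,y$ and edges $v'_{13}x$ and $xy$ (i.e. the edge $v_{13}v'_{13}$ is replaced by a path $v_{13}v'_{13}xy$ on four vertices). *)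

(* Defs.v *)
From mathcomp Require Import all_boot all_order all_algebra.
Set Implicit Arguments. Unset Strict Implicit. Unset Printing Implicit Defensive.
Import Order.TTheory GRing.Theory Num.Theory.

(* A finite simple graph: vertex type T : finType, adjacency e : rel T
   (symmetric, irreflexive for the graphs we build). *)

Definition independent (T : finType) (e : rel T) (S : {set T}) : bool :=
  [forall x in S, forall y in S, ~~ e x y].

Definition indep_count (T : finType) (e : rel T) (k : nat) : nat :=
  #|[set S : {set T} | independent e S && (#|S| == k)]|.

(* Independence polynomial I_G(t) = sum_k i_k t^k  (i_k = 0 for k > #|T|). *)
Definition indep_poly (T : finType) (e : rel T) : {poly int} :=
  \poly_(k < #|T|.+1) Posz (indep_count e k).

Definition unimodal_seq (s : seq int) : Prop :=
  exists j : nat,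
    (forall i : nat, (i < j)%N -> (s`_i <= s`_i.+1)%R) /\
    (forall i : nat, (j <= i)%N -> (i.+1 < size s)%N -> (s`_i.+1 <= s`_i)%R).

Definition unimodal_poly (p : {poly int}) : Prop := unimodal_seq (polyseq p).

(* The tree T*_{3,m,n}, vertices labelled 0 .. 12+2m+2n-1, with c := 3+m+n:
     0                 : v0 (root)
     1, 2, 3           : v1, v2, v3 (children of v0)
     4 .. 4+c-1        : grandchildren; label 4+g with
                           g < 3        : v_{1,g+1}  (child of v1)
                           3 <= g < 3+m : v_{2,g-2}  (child of v2)
                           3+m <= g < c : v_{3,g-2-m}(child of v3)
     4+c .. 4+2c-1     : label 4+c+g is the leaf v'_{..} attached to 4+g
     4+2c              : x, attached to v'_{13} (label 4+c+2)
     4+2c+1            : y, attached to x.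
   tstar_parent k is the parent of k (the root is given itself). *)
Definition tstar_parent (m n k : nat) : nat :=
  let c := (3 + m + n)%N in
  if k == 0%N then 0%N
  else if (k <= 3)%N then 0%N
  else if (k < 4 + c)%N then
    (let g := (k - 4)%N in
     if (g < 3)%N then 1%N else if (g < 3 + m)%N then 2%N else 3%N)
  else if (k < 4 + 2 * c)%N then (k - c)%N
  else if k == (4 + 2 * c)%N then (4 + c + 2)%N
  else (4 + 2 * c)%N.

Definition tstar_size (m n : nat) : nat := (12 + 2 * m + 2 * n)%N.

Definition tstar_adj (m n : nat) : rel 'I_(tstar_size m n) :=
  fun x y => (x != y) &&
    ((tstar_parent m n x == y) || (tstar_parent m n y == x)).

(* Main.v *)
Require Import Defs.
From Stdlib Require Import ZArith.
From mathcomp Require Import all_boot all_order all_algebra.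
From mathcomp Require Import zify ssrZ ring.
Set Implicit Arguments. Unset Strict Implicit. Unset Printing Implicit Defensive.
Import Order.TTheory GRing.Theory Num.Theory.
Local Open Scope ring_scope.

(** Write a = 1 + 2t, b = 1 + t, N = m + n.  Deleting the root splits the
    independence polynomial as A B_m B_n + t G a^(N+2), where A is the polynomial
    of the branch at v1, B_k = a^k + t b^k and G = (1 + t)(1 + 3t).  Both summands
    are log-concave, so it is enough to find p such that both increase strictly
    from p - 1 to p and decrease strictly from p + 1 to p + 2; p = floor(2N/3) + 3
    works.

    For the second summand this is an explicit inequality between binomial
    coefficients.  The first one expands as
    A a^N + t A (a^m b^n + a^n b^m) + t^2 A b^N, and since b = (1 + a) / 2 the last
    three terms are averages of t A b a^M and t^2 A b a^M with M < N.  The increment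
    of A b a^M at a fixed degree first decreases and then increases with M, so its
    minimum is attained at an explicit M = N - 4 or N - 5, where it is compared with
    the increment of A a^N.  After clearing factorials, each of these comparisons is
    the positivity of a polynomial in floor(N/3) with positive coefficients. *)

(** * Log-concave polynomials *)

(** Asking for all [i <= j], not just [j = i + 1], excludes internal zeros and makes the class
    closed under products. *)
Definition log_concave (P : {poly int}) : Prop :=
  (forall i, 0 <= P`_i) /\
  (forall i j, (i <= j)%N -> P`_i * P`_j.+1 <= P`_i.+1 * P`_j).

Lemma log_concave_shift P a c n : log_concave P -> (a <= c)%N ->
  P`_a * P`_(c + n) <= P`_(a + n) * P`_c.
Proof.
move=> [P_ge0 lcP]; elim: n a => [|n IHn] a le_ac; first by rewrite !addn0.
case: (ltngtP a c) le_ac => // [lt_ac|->] _; last by rewrite mulrC.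
rewrite addnS; apply: le_trans (lcP a (c + n)%N _) _; first by lia.
by rewrite addnS -addSn; apply: IHn.
Qed.

(** Entry of the lower triangular Toeplitz matrix that acts on coefficient vectors as multiplication
    by [P]; log-concavity makes its 2x2 minors nonnegative. *)
Definition toeplitz (P : {poly int}) (r s : nat) : int :=
  if (s <= r)%N then P`_(r - s) else 0.

Lemma toeplitz_ge0 P r s : log_concave P -> 0 <= toeplitz P r s.
Proof. by case=> P_ge0 _; rewrite /toeplitz; case: ifP. Qed.

Lemma toeplitz_minor_ge0 P r1 r2 s t : log_concave P ->
    (r1 <= r2)%N -> (s <= t)%N ->
  0 <= toeplitz P r1 s * toeplitz P r2 t - toeplitz P r1 t * toeplitz P r2 s.
Proof.
move=> lcP le_r le_st; rewrite subr_ge0.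
case: (leqP t r1) => [le_tr|lt_rt]; last first.
  by rewrite [toeplitz P r1 t]/toeplitz leqNgt lt_rt mul0r mulr_ge0 ?toeplitz_ge0.
rewrite /toeplitz le_tr (leq_trans le_st le_tr) (leq_trans le_tr le_r).
rewrite (leq_trans le_st (leq_trans le_tr le_r)).
have := @log_concave_shift P (r1 - t) (r2 - t) (t - s) lcP.
have -> : (r2 - t + (t - s) = r2 - s)%N by lia.
have -> : (r1 - t + (t - s) = r1 - s)%N by lia.
by apply; lia.
Qed.

Lemma coefM_toeplitz (P Q : {poly int}) r n : (r < n)%N ->
  (P * Q)`_r = \sum_(s < n) toeplitz P r s * Q`_s.
Proof.
move=> lt_rn; rewrite coefMr (big_ord_widen n (fun s => P`_(r - s) * Q`_s)) //.
rewrite big_mkcond; apply: eq_bigr => s _; rewrite /toeplitz ltnS.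
by case: ifP => // _; rewrite mul0r.
Qed.

(* Twice a 2x2 minor of the product is, by Cauchy-Binet, a sum of products of
   2x2 minors of the factors. *)
Lemma log_concaveM P Q : log_concave P -> log_concave Q -> log_concave (P * Q).
Proof.
move=> lcP lcQ; have [[P_ge0 _] [Q_ge0 lcQ2]] := (lcP, lcQ); split.
  by move=> i; rewrite coefM sumr_ge0 // => j _; rewrite mulr_ge0.
move=> i j le_ij; pose n := j.+2; have lt_in : (i.+1 < n)%N by [].
(* All four coefficients now come from rows [i + 1] and [j + 1] of the matrix of [P], applied to [Q]
   and [X Q]. *)
have shiftQ k : (P * Q)`_k = (P * ('X * Q))`_k.+1.
  by rewrite mulrCA coefXM.
rewrite (shiftQ i) (shiftQ j) !(@coefM_toeplitz _ _ _ n) //.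
rewrite -subr_ge0 !mulr_suml.
pose x1 (s : 'I_n) := toeplitz P i.+1 s; pose x2 (s : 'I_n) := toeplitz P j.+1 s.
pose y (s : 'I_n) := Q`_s; pose y' (s : 'I_n) := ('X * Q)`_s.
pose term s t := x1 s * x2 t * (y s * y' t - y' s * y t).
have -> : \sum_(s < n) x1 s * y s * (\sum_(t < n) x2 t * y' t) -
          \sum_(s < n) x1 s * y' s * (\sum_(t < n) x2 t * y t) =
          \sum_(s < n) \sum_(t < n) term s t.
  rewrite -sumrB; apply: eq_bigr => s _; rewrite !mulr_sumr -sumrB.
  by apply: eq_bigr => t _; rewrite /term; ring.
have y_minor (s t : 'I_n) : (s <= t)%N -> 0 <= y s * y' t - y' s * y t.
  rewrite /y /y' !coefXM subr_ge0; case: t => [[|t] lt_t] /=.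
    by case: s => [[|s] ?] //=; rewrite mul0r mulr0.
  case: s => [[|s] lt_s] //= le_st; first by rewrite mul0r mulr_ge0.
  by apply: lcQ2; lia.
have sym : 0 <= \sum_(s < n) \sum_(t < n) (term s t + term t s).
  apply: sumr_ge0 => s _; apply: sumr_ge0 => t _.
  have -> : term s t + term t s =
      (x1 s * x2 t - x1 t * x2 s) * (y s * y' t - y' s * y t).
    by rewrite /term; ring.
  case: (leqP s t) => [le_st|/ltnW le_ts].
    by rewrite mulr_ge0 ?y_minor ?toeplitz_minor_ge0 ?ltnS.
  (* For [t <= s] both minors are nonpositive, so their product is still nonnegative. *)
  rewrite -mulrNN mulr_ge0 // opprB; first exact: toeplitz_minor_ge0.
  by rewrite mulrC [y s * _]mulrC y_minor.
have : \sum_(s < n) \sum_(t < n) (term s t + term t s) =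
       (\sum_(s < n) \sum_(t < n) term s t) *+ 2.
  rewrite mulr2n [X in _ = _ + X]exchange_big -big_split /=; apply: eq_bigr => s _.
  by rewrite -big_split.
by move=> E; move: sym; rewrite E pmulrn_lge0.
Qed.

Lemma log_concave_linear (c d : int) : 0 <= c -> 0 <= d ->
  log_concave (c%:P + d *: 'X).
Proof.
move=> c_ge0 d_ge0.
have coef k : (c%:P + d *: 'X)`_k = if k is k'.+1 then d *+ (k' == 0%N) else c.
  by rewrite coefD coefC coefZ coefX; case: k => [|[|k]] /=; rewrite ?mulr0 ?addr0 ?add0r ?mulr1.
split=> [[|[|i]]|[|i] [|j] // _]; rewrite !coef //= ?mulr0n ?mulr0 ?mul0r //.
  by rewrite mulrC.
by rewrite mulr_ge0 // mulrn_wge0.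
Qed.

Lemma log_concave1 : log_concave 1.
Proof. by have := @log_concave_linear 1 0; rewrite scale0r addr0; apply. Qed.

Lemma log_concaveX P n : log_concave P -> log_concave (P ^+ n).
Proof.
move=> lcP; elim: n => [|n IHn]; first by rewrite expr0; apply: log_concave1.
by rewrite exprS; apply: log_concaveM.
Qed.

(** On the support the local inequalities say that ratios of consecutive coefficients decrease; they
    are chained by induction on [j - i], cancelling a positive coefficient. *)
Lemma log_concave_local (P : {poly int}) d : (forall i, (i <= d)%N -> 0 < P`_i) ->
    (forall i, (d < i)%N -> P`_i = 0) ->
    (forall i, (i.+2 <= d)%N -> P`_i * P`_i.+2 <= P`_i.+1 ^+ 2) ->
  log_concave P.
Proof.
move=> P_gt0 P_eq0 loc.
have P_ge0 i : 0 <= P`_i.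
  by case: (leqP i d) => [/P_gt0/ltW //|/P_eq0 ->].
split=> // i j /subnK <-; elim: (j - i)%N => [|k IHk]; first by rewrite mulrC.
rewrite addSn; move: (k + i)%N IHk => l IHl.
case: (leqP l.+2 d) => [le_ld|/P_eq0 ->]; last by rewrite mulr0 mulr_ge0.
have Pl_gt0 : 0 < P`_l by apply: P_gt0; lia.
rewrite -(ler_pM2r Pl_gt0) -mulrA [P`_l.+2 * _]mulrC.
apply: le_trans (ler_wpM2l (P_ge0 i) (loc _ le_ld)) _.
by rewrite expr2 mulrA [leRHS]mulrAC; apply: ler_wpM2r.
Qed.

(** * Increments of coefficient sequences *)

Definition dcoef (k : nat) (P : {poly int}) : int := ((1 - 'X) * P)`_k.

Lemma dcoef0 (P : {poly int}) : dcoef 0 P = P`_0.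
Proof. by rewrite /dcoef mulrBl mul1r coefB coefXM subr0. Qed.

Lemma dcoefS k P : dcoef k.+1 P = P`_k.+1 - P`_k.
Proof. by rewrite /dcoef mulrBl mul1r coefB coefXM. Qed.

Lemma dcoefD k P Q : dcoef k (P + Q) = dcoef k P + dcoef k Q.
Proof. by rewrite /dcoef mulrDr coefD. Qed.

Lemma dcoefXM k P : dcoef k.+1 ('X * P) = dcoef k P.
Proof. by rewrite /dcoef mulrCA coefXM. Qed.

(** A strict rise at [k] makes P_k positive, so it cancels from P_(i-1) P_k <= P_i P_(k-1) <= P_i
    P_k. *)
Lemma dcoef_gt0_down P i k : log_concave P -> 0 < dcoef k P -> (i <= k)%N ->
  0 <= dcoef i P.
Proof.
move=> [P_ge0 lcP]; case: i => [|i]; first by rewrite dcoef0.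
case: k => // k; rewrite !dcoefS subr_gt0 subr_ge0 ltnS => lt_Pk le_ik.
have Pk_gt0 : 0 < P`_k.+1 by apply: le_lt_trans lt_Pk.
rewrite -(ler_pM2r Pk_gt0); apply: le_trans (lcP i k le_ik) _.
by apply: ler_wpM2l => //; apply: ltW.
Qed.

Lemma dcoef_lt0_up P i k : log_concave P -> dcoef k P < 0 -> (k <= i)%N ->
  dcoef i P <= 0.
Proof.
move=> [P_ge0 lcP]; case: k => [|k]; first by rewrite dcoef0 ltNge P_ge0.
case: i => // i; rewrite !dcoefS subr_lt0 subr_le0 ltnS => lt_Pk le_ki.
have Pk_gt0 : 0 < P`_k by apply: le_lt_trans lt_Pk.
rewrite -(ler_pM2l Pk_gt0); apply: le_trans (lcP k i le_ki) _.
by apply: ler_wpM2r => //; apply: ltW.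
Qed.

(** * Coefficients of multiples of powers of 1 + 2X *)

Definition pa : {poly int} := 1 + 2 * 'X.
Definition pb : {poly int} := 1 + 'X.

Lemma coef_paX M k : (pa ^+ M)`_k = 'C(M, k)%:Z * 2 ^+ k.
Proof.
elim: M k => [|M IHM] k.
  by rewrite expr0 coef1 bin0n; case: k => [|k] //=; rewrite mul0r.
rewrite exprS mulrDl mul1r -mulrA coefD mulr_natl coefMn coefXM.
case: k => [|k] /=; first by rewrite mul0rn addr0 IHM !bin0.
by rewrite !IHM binS PoszD exprS; ring.
Qed.

(** The falling factorial over the integers, where it is a polynomial in [x]. *)
Fixpoint fall (x : int) (i : nat) : int :=
  if i is i'.+1 then x * fall (x - 1) i' else 1.

Lemma ffact_fall (k i : nat) : (k ^_ i)%:Z = fall k i.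
Proof.
elim: i k => [|i IHi] k //=; rewrite ffactnS PoszM IHi.
by case: k => [|k]; rewrite ?mul0r // -addn1 PoszD addrK addn1.
Qed.

Lemma coef_Poly_mul (s : seq int) (Q : {poly int}) d k : (size s <= d)%N ->
  (Poly s * Q)`_k = \sum_(i < d) s`_i * (if (k < i)%N then 0 else Q`_(k - i)).
Proof.
move=> le_sd; have -> : Poly s = \poly_(i < d) s`_i.
  apply/polyP => i; rewrite coef_Poly coef_poly; case: ifP => // /negbT.
  by rewrite -leqNgt => le_di; rewrite nth_default // (leq_trans le_sd).
rewrite poly_def mulr_suml coef_sum; apply: eq_bigr => i _.
by rewrite -scalerAl coefZ coefXnM.
Qed.

(** Here [w] stands for M + d - k. The value is a polynomial in [k] and [w], hence in r when both
    are affine in r. *)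
Definition scaled_coef (s : seq int) (d : nat) (k w : int) : int :=
  \sum_(i < d.+1) s`_i * 2 ^+ (d - i) * fall k i * fall w (d - i).

(* Multiplying by 2^d k! (M+d-k)! clears all denominators of
   C(M,k-i) = M! / ((k-i)! (M-k+i)!), and the junk terms with k < i or
   M < k - i vanish on both sides. *)
Lemma coef_scaled s d k w M : (size s <= d.+1)%N -> (w + k = M + d)%N ->
  2 ^+ d * (k`! * w`!)%:Z * (Poly s * pa ^+ M)`_k =
  M`!%:Z * 2 ^+ k * scaled_coef s d k w.
Proof.
move=> le_sd eq_wk; rewrite (coef_Poly_mul _ _ le_sd) !mulr_sumr.
apply: eq_bigr => -[i le_id] _ /=; rewrite ltnS in le_id.
rewrite -!ffact_fall; case: ltnP => [lt_ki|le_ik].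
  by rewrite (ffact_small lt_ki) !(mulr0, mul0r).
rewrite coef_paX; case: (leqP (k - i) M) => [le_kM|lt_Mk]; last first.
  by rewrite bin_small // (@ffact_small w) ?(mulr0, mul0r) //; lia.
have Ek := ffact_fact le_ik.
have le_w : (d - i <= w)%N by lia.
have Ew := ffact_fact le_w.
have EM := bin_fact le_kM.
have Ewi : (w - (d - i) = M - (k - i))%N by lia.
rewrite Ewi in Ew; rewrite -Ek -Ew -EM.
have -> : (2 : int) ^+ d = 2 ^+ i * 2 ^+ (d - i) by rewrite -exprD subnKC.
have -> : (2 : int) ^+ k = 2 ^+ i * 2 ^+ (k - i) by rewrite -exprD subnKC.
by rewrite !PoszM; ring.
Qed.

Lemma fact_fall (n i : nat) : (i <= n)%N -> n`!%:Z = fall n i * (n - i)`!%:Z.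
Proof. by move=> le_in; rewrite -ffact_fall -PoszM ffact_fact. Qed.

(** The two coefficients clear different factorials. Scaling by the larger ones and factoring out
    the smaller [M1] and [k1] parts leaves only falling factorials whose lengths are index
    differences. *)
Lemma coef_combination_scaled (c : int) s1 s2 d k1 k2 w1 w2 w M1 M2 :
    (size s1 <= d.+1)%N -> (size s2 <= d.+1)%N ->
    (w1 + k1 = M1 + d)%N -> (w2 + k2 = M2 + d)%N ->
    (k1 <= k2)%N -> (M1 <= M2)%N -> (w1 <= w)%N -> (w2 <= w)%N ->
  2 ^+ d * (k2`! * w`!)%:Z *
    (c * (Poly s1 * pa ^+ M1)`_k1 + (Poly s2 * pa ^+ M2)`_k2) =
  M1`!%:Z * 2 ^+ k1 *
    (c * fall k2 (k2 - k1) * fall w (w - w1) * scaled_coef s1 d k1 w1 +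
     2 ^+ (k2 - k1) * fall M2 (M2 - M1) * fall w (w - w2) *
       scaled_coef s2 d k2 w2).
Proof.
move=> s1_le s2_le e1 e2 le_k le_M le_w1 le_w2.
have E1 := coef_scaled s1_le e1; have E2 := coef_scaled s2_le e2.
have Fk := fact_fall (leq_subr k1 k2); rewrite subKn // in Fk.
have FM := fact_fall (leq_subr M1 M2); rewrite subKn // in FM.
have Fw1 := fact_fall (leq_subr w1 w); rewrite subKn // in Fw1.
have Fw2 := fact_fall (leq_subr w2 w); rewrite subKn // in Fw2.
have Ek : (2 : int) ^+ k2 = 2 ^+ k1 * 2 ^+ (k2 - k1) by rewrite -exprD subnKC.
rewrite FM Ek in E2.
transitivity (c * fall k2 (k2 - k1) * fall w (w - w1) *
    (2 ^+ d * (k1`! * w1`!)%:Z * (Poly s1 * pa ^+ M1)`_k1) +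
  fall w (w - w2) * (2 ^+ d * (k2`! * w2`!)%:Z * (Poly s2 * pa ^+ M2)`_k2)).
  rewrite mulrDr; congr (_ + _).
    by rewrite !PoszM Fk Fw1; ring.
  by rewrite !PoszM Fw2; ring.
by rewrite E1 E2; ring.
Qed.

(** * Deciding signs uniformly in N *)

Lemma int_of_ZD a b : int_of_Z (Z.add a b) = int_of_Z a + int_of_Z b.
Proof. exact: (rmorphD int_of_Z). Qed.

Lemma int_of_ZM a b : int_of_Z (Z.mul a b) = int_of_Z a * int_of_Z b.
Proof. exact: (rmorphM int_of_Z). Qed.

Lemma int_of_Z_nat n : int_of_Z (Z.of_nat n) = n%:Z.
Proof. exact: (Z_of_intK n). Qed.

(* Polynomials in the parameter r as lists of binary integers, lowest degree
   first, so that their signs can be decided by computation. *)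
Definition zeval (l : seq Z) (x : int) : int :=
  foldr (fun c acc => int_of_Z c + x * acc) 0 l.

Fixpoint zadd (l1 l2 : seq Z) : seq Z :=
  match l1, l2 with
  | [::], _ => l2
  | _, [::] => l1
  | a :: l1', b :: l2' => Z.add a b :: zadd l1' l2'
  end.

Definition zscale (c : Z) (l : seq Z) : seq Z := map (Z.mul c) l.

Fixpoint zmul (l1 l2 : seq Z) : seq Z :=
  if l1 is a :: l1' then zadd (zscale a l2) (Z0 :: zmul l1' l2) else [::].

Fixpoint zfall (l : seq Z) (i : nat) : seq Z :=
  if i is i'.+1 then zmul l (zfall (zadd l [:: Zneg xH]) i') else [:: Zpos xH].

Definition zscaled (s : seq Z) (d : nat) (k w : seq Z) : seq Z :=
  foldr zadd [::] [seq zscale (Z.mul (nth Z0 s i) (Z.pow (Zpos (xO xH)) (Z.of_nat (d - i))))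
                         (zmul (zfall k i) (zfall w (d - i))) | i <- iota 0 d.+1].

(** A sufficient test for positivity at every natural number, 0 included. *)
Definition zpos (l : seq Z) : bool :=
  if l is c :: l' then Z.ltb Z0 c && all (Z.leb Z0) l' else false.

Lemma zeval_add l1 l2 x : zeval (zadd l1 l2) x = zeval l1 x + zeval l2 x.
Proof.
elim: l1 l2 => [|a l1 IH] [|b l2] /=; rewrite ?add0r ?addr0 //.
by rewrite IH int_of_ZD; ring.
Qed.

Lemma zeval_scale c l x : zeval (zscale c l) x = int_of_Z c * zeval l x.
Proof. by elim: l => [|a l IH] /=; rewrite ?mulr0 // IH int_of_ZM; ring. Qed.

Lemma zeval_mul l1 l2 x : zeval (zmul l1 l2) x = zeval l1 x * zeval l2 x.
Proof.
elim: l1 => [|a l1 IH] /=; rewrite ?mul0r // zeval_add zeval_scale /= IH.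
by ring.
Qed.

Lemma zeval_fall l i x : zeval (zfall l i) x = fall (zeval l x) i.
Proof.
elim: i l => [|i IH] l /=; first by rewrite mulr0 addr0.
by rewrite zeval_mul IH zeval_add /= mulr0 addr0.
Qed.

Lemma int_of_Z_pow2 n : int_of_Z (Z.pow (Zpos (xO xH)) (Z.of_nat n)) = 2 ^+ n.
Proof.
elim: n => [|n IH] //; rewrite Nat2Z.inj_succ Z.pow_succ_r; last by lia.
by rewrite int_of_ZM IH exprS.
Qed.

Lemma zeval_scaled s d k w x :
  zeval (zscaled s d k w) x =
  scaled_coef (map int_of_Z s) d (zeval k x) (zeval w x).
Proof.
rewrite /scaled_coef -(big_mkord xpredT (fun i => (map int_of_Z s)`_i *
  2 ^+ (d - i) * fall (zeval k x) i * fall (zeval w x) (d - i))).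
rewrite /index_iota subn0 /zscaled; elim: (iota 0 d.+1) => [|i t IH].
  by rewrite big_nil.
rewrite big_cons /= zeval_add IH zeval_scale int_of_ZM int_of_Z_pow2.
rewrite zeval_mul !zeval_fall !mulrA; congr (_ * _ * _ * _ + _).
case: (ltnP i (size s)) => lt_is; first by rewrite (nth_map Z0).
by rewrite !nth_default ?size_map.
Qed.

Lemma zpos_gt0 l (r : nat) : zpos l -> 0 < zeval l r.
Proof.
case: l => [|c l] //= /andP[c_gt0 l_ge0].
have : 0 <= zeval l r.
  elim: l l_ge0 => [|a l IH] //= /andP[a_ge0 /IH l_ge0].
  by rewrite addr_ge0 ?mulr_ge0 //; lia.
by move=> ?; rewrite ltr_pwDl ?mulr_ge0 //; lia.
Qed.

Definition zlin (c s : nat) : seq Z := [:: Z.of_nat c; Z.of_nat s].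

Lemma zeval_lin c s (r : nat) : zeval (zlin c s) r = (c + s * r)%N.
Proof. by rewrite /= !int_of_Z_nat mulr0 addr0 mulrC -PoszM -PoszD. Qed.

(* Soundness is [check_signP]: the degree k0 + k1 r and the exponent M0 + M1 r
   are affine in r, and e = 1 or -1 selects the sign. *)
Definition check_sign (e : Z) (s : seq Z) (d k0 k1 M0 M1 : nat) : bool :=
  [&& size s <= d.+1, k0 <= M0 + d, k1 <= M1 &
    zpos (zscale e (zscaled s d (zlin k0 k1) (zlin (M0 + d - k0) (M1 - k1))))]%N.

Lemma check_signP e s d k0 k1 M0 M1 (r : nat) :
    check_sign e s d k0 k1 M0 M1 ->
  0 < int_of_Z e * (Poly (map int_of_Z s) * pa ^+ (M0 + M1 * r))`_(k0 + k1 * r).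
Proof.
case/and4P=> le_sd le_k0 le_k1 /zpos_gt0-/(_ r).
rewrite zeval_scale zeval_scaled !zeval_lin.
set k := (k0 + k1 * r)%N; set M := (M0 + M1 * r)%N.
set w := (_ - k0 + _)%N => pos.
have eq_wk : (w + k = M + d)%N by rewrite /w /k /M; nia.
have scale_gt0 : 0 < 2 ^+ d * (k`! * w`!)%:Z.
  by rewrite mulr_gt0 ?exprn_gt0 // ltz_nat muln_gt0 !fact_gt0.
have factor_gt0 : 0 < M`!%:Z * 2 ^+ k.
  by rewrite mulr_gt0 ?exprn_gt0 // ltz_nat fact_gt0.
rewrite -(pmulr_rgt0 _ scale_gt0) mulrCA coef_scaled ?size_map //.
by rewrite mulrCA pmulr_rgt0.
Qed.

(** Sign test for [c] times one coefficient plus another. Both share the slopes [k1] and [M1], so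
    the index differences do not depend on r. *)
Definition check_sign2 (e c : Z) (s1 s2 : seq Z) (d ka kb k1 Ma Mb M1 : nat) :=
  let wa := (Ma + d - ka)%N in let wb := (Mb + d - kb)%N in
  let w := maxn wa wb in let lw := zlin w (M1 - k1) in
  [&& size s1 <= d.+1, size s2 <= d.+1, ka <= Ma + d, kb <= Mb + d,
      k1 <= M1, ka <= kb, Ma <= Mb &
    zpos (zscale e (zadd
      (zscale c (zmul (zfall (zlin kb k1) (kb - ka))
        (zmul (zfall lw (w - wa))
           (zscaled s1 d (zlin ka k1) (zlin wa (M1 - k1))))))
      (zscale (Z.pow (Zpos (xO xH)) (Z.of_nat (kb - ka)))
        (zmul (zfall (zlin Mb M1) (Mb - Ma))
        (zmul (zfall lw (w - wb))
           (zscaled s2 d (zlin kb k1) (zlin wb (M1 - k1))))))))]%N.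

Lemma check_sign2P e c s1 s2 d ka kb k1 Ma Mb M1 (r : nat) :
    check_sign2 e c s1 s2 d ka kb k1 Ma Mb M1 ->
  0 < int_of_Z e *
    (int_of_Z c * (Poly (map int_of_Z s1) * pa ^+ (Ma + M1 * r))`_(ka + k1 * r) +
     (Poly (map int_of_Z s2) * pa ^+ (Mb + M1 * r))`_(kb + k1 * r)).
Proof.
rewrite /check_sign2; set wa := (Ma + d - ka)%N; set wb := (Mb + d - kb)%N.
case/and5P=> le_s1 le_s2 le_ka le_kb /and4P[le_k1 le_kab le_Mab].
move=> /zpos_gt0-/(_ r); rewrite zeval_scale zeval_add !zeval_scale.
rewrite !zeval_mul !zeval_fall !zeval_scaled !zeval_lin int_of_Z_pow2.
set w := maxn wa wb; set ka' := (ka + k1 * r)%N; set kb' := (kb + k1 * r)%N.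
set Ma' := (Ma + M1 * r)%N; set Mb' := (Mb + M1 * r)%N.
set w' := (w + _)%N; set wa' := (wa + _)%N; set wb' := (wb + _)%N => pos.
have eq_a : (wa' + ka' = Ma' + d)%N by rewrite /wa' /ka' /Ma' /wa; nia.
have eq_b : (wb' + kb' = Mb' + d)%N by rewrite /wb' /kb' /Mb' /wb; nia.
have le_k : (ka' <= kb')%N by rewrite leq_add2r.
have le_M : (Ma' <= Mb')%N by rewrite leq_add2r.
have le_wa : (wa' <= w')%N by rewrite leq_add2r leq_maxl.
have le_wb : (wb' <= w')%N by rewrite leq_add2r leq_maxr.
have scale_gt0 : 0 < 2 ^+ d * (kb'`! * w'`!)%:Z.
  by rewrite mulr_gt0 ?exprn_gt0 // ltz_nat muln_gt0 !fact_gt0.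
have factor_gt0 : 0 < Ma'`!%:Z * 2 ^+ ka'.
  by rewrite mulr_gt0 ?exprn_gt0 // ltz_nat fact_gt0.
rewrite -(pmulr_rgt0 _ scale_gt0) mulrCA.
rewrite (@coef_combination_scaled _ _ _ d _ _ wa' wb' w') ?size_map //.
by rewrite mulrCA pmulr_rgt0 // !subnDr; move: pos; rewrite -!mulrA.
Qed.

(* Coefficients of (1 - X) A, (1 - X) A b and (1 - X) G. *)
Definition dA : seq int := [:: 1; 8; 19; 8; -19; -16; -1].
Definition dAb : seq int := [:: 1; 9; 27; 27; -11; -35; -17; -1].
Definition dG : seq int := [:: 1; 3; -1; -3].

(* For N = N0 + N1 r the candidate p is p0 + p1 r, and q = N - M at the minimising M. *)
Definition check_mode (N0 N1 p0 p1 q : nat) : bool :=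
  let pos := Zpos xH in let neg := Zneg xH in
  let sA := map Z_of_int dA in let sAb := map Z_of_int dAb in
  let sG := map Z_of_int dG in
  [&& check_sign pos sA 7 p0 p1 N0 N1,
      check_sign2 pos (Zpos 4%positive) sAb sA 7 (p0 - 1) p0 p1 (N0 - q) N0 N1,
      ((N0 == q) && (N1 == 0)) || ((q < N0) && check_sign neg sAb 7 (p0 - 2) p1 (N0 - q.+1) N1),
      check_sign pos sAb 7 (p0 - 2) p1 (N0 - q) N1,
      check_sign neg sA 7 (p0 + 2) p1 N0 N1,
      check_sign neg sAb 7 (p0 + 1) p1 (N0 - 1) N1,
      check_sign2 neg pos sAb sA 7 p0 (p0 + 2) p1 (N0 - 1) N0 N1,
      check_sign pos sG 3 (p0 - 1) p1 (N0 + 2) N1 &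
      check_sign neg sG 3 (p0 + 1) p1 (N0 + 2) N1]%N.

(** * Location of the mode *)

(* The branch at v1, and the path v13 v'13 x y. *)
Definition pA : {poly int} :=
  1 + 9 * 'X + 28 * 'X^2 + 36 * 'X^3 + 17 * 'X^4 + 'X^5.
Definition pG : {poly int} := (1 + 'X) * (1 + 3 * 'X).

Lemma dcoef_pA k M : dcoef k (pA * pa ^+ M) = (Poly dA * pa ^+ M)`_k.
Proof.
rewrite /dcoef mulrA; congr (polyseq (_ * _))`_k.
by rewrite /pA /dA /= !cons_poly_def !rmorphN !rmorph_nat /=; ring.
Qed.

Lemma dcoef_pAb k M : dcoef k (pA * pb * pa ^+ M) = (Poly dAb * pa ^+ M)`_k.
Proof.
rewrite /dcoef mulrA; congr (polyseq (_ * _))`_k.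
by rewrite /pA /pb /dAb /= !cons_poly_def !rmorphN !rmorph_nat /=; ring.
Qed.

Lemma dcoef_pG k M : dcoef k (pG * pa ^+ M) = (Poly dG * pa ^+ M)`_k.
Proof.
rewrite /dcoef mulrA; congr (polyseq (_ * _))`_k.
by rewrite /pG /dG /= !cons_poly_def !rmorphN !rmorph_nat /=; ring.
Qed.

(** * Growth of the increments with the exponent *)

Section Growth.
Variable Q : {poly int}.
Hypothesis lcQ : forall M, log_concave (Q * pa ^+ M).
Let H M := Q * pa ^+ M.

(** This is a^(M+1) = a^M + 2 X a^M, read at one degree. *)
Lemma dcoef_succ j M :
  dcoef j.+1 (H M.+1) = dcoef j.+1 (H M) + 2 * dcoef j (H M).
Proof.
have -> : H M.+1 = H M + ('X * H M + 'X * H M) by rewrite /H exprS /pa; ring.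
by rewrite !dcoefD !dcoefXM; ring.
Qed.

Lemma dcoef_gt0_succ j M : 0 < dcoef j.+1 (H M) -> 0 < dcoef j.+1 (H M.+1).
Proof.
move=> gt0; rewrite dcoef_succ.
have : 0 <= dcoef j (H M) := dcoef_gt0_down (lcQ M) gt0 (leqnSn j).
lia.
Qed.

Lemma dcoef_gt0_mono j M M' : (M <= M')%N -> 0 < dcoef j.+1 (H M) ->
  0 < dcoef j.+1 (H M').
Proof.
move=> /subnK <-; elim: (M' - M)%N => [|k IHk] // gt0.
by rewrite addSn dcoef_gt0_succ ?IHk.
Qed.

(* As M grows, the increment at j.+2 first decreases and then increases,
   according to the sign of the increment at j.+1. *)
Lemma dcoef_min j M0 M : 0 < dcoef j.+1 (H M0) ->
    M0 = 0%N \/ (exists2 M1, M0 = M1.+1 & dcoef j.+1 (H M1) <= 0) ->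
  dcoef j.+2 (H M0) <= dcoef j.+2 (H M).
Proof.
move=> gt0 le0; case: (leqP M0 M) => [/subnK <-|lt_M].
  elim: (M - M0)%N => [|k IHk] //; rewrite addSn dcoef_succ.
  have := dcoef_gt0_mono (leq_addl k M0) gt0; lia.
case: le0 => [M0_eq0|[M1 eM0 le0]]; first by rewrite M0_eq0 in lt_M.
have {lt_M} le_M : (M <= M1)%N by lia.
(* A positive increment at [j.+1] would persist up to [M1], where it is nonpositive. *)
have step M' : (M' <= M1)%N -> dcoef j.+2 (H M'.+1) <= dcoef j.+2 (H M').
  move=> le_M'; rewrite dcoef_succ.
  have : dcoef j.+1 (H M') <= 0.
    by rewrite leNgt; apply/negP => /(dcoef_gt0_mono le_M'); lia.
  lia.
rewrite {}eM0; move: step; rewrite -(subnK le_M).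
elim: (M1 - M)%N => [|k IHk] step; first exact: step.
rewrite !addSn; apply: le_trans (step (k + M).+1 _) _ => //.
by apply: IHk => M' le_M'; apply: step; lia.
Qed.

Lemma dcoef_max j M M' : (M <= M')%N -> 0 < dcoef j.+1 (H M) ->
  dcoef j.+1 (H M) <= dcoef j.+1 (H M').
Proof.
move=> /subnK <- gt0; elim: (M' - M)%N => [|k IHk] //.
rewrite addSn dcoef_succ.
have : 0 <= dcoef j (H (k + M)) :=
  dcoef_gt0_down (lcQ (k + M)) (dcoef_gt0_mono (leq_addl k M) gt0) (leqnSn j).
lia.
Qed.

End Growth.

(* Since b = (1 + a) / 2, the product a^i b^j is an average of powers of a. *)
Lemma average_pa_pb (L : {poly int} -> int) Q c N :
    (forall P R, L (P + R) = L P + L R) ->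
    (forall M, (M <= N)%N -> c <= L (Q * pa ^+ M)) ->
  forall i j, (i + j <= N)%N -> c <= L (Q * (pa ^+ i * pb ^+ j)).
Proof.
move=> LD Lpa i j; elim: j i => [|j IHj] i le_ij.
  by rewrite mulr1 Lpa; lia.
(* Uses 2 b = 1 + a; both new exponent pairs still have sum at most [N]. *)
have : L (Q * (pa ^+ i * pb ^+ j.+1)) + L (Q * (pa ^+ i * pb ^+ j.+1)) =
       L (Q * (pa ^+ i * pb ^+ j)) + L (Q * (pa ^+ i.+1 * pb ^+ j)).
  by rewrite -!LD !exprS /pa /pb; congr L; ring.
have := IHj i; have := IHj i.+1; lia.
Qed.

(** * Log-concavity of the factors *)

Lemma log_concave_pb : log_concave pb.
Proof.
have -> : pb = 1%:P + 1 *: 'X by rewrite scale1r.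
exact: log_concave_linear.
Qed.

Lemma log_concave_natX (k : nat) : log_concave (1 + k%:R * 'X).
Proof.
have -> : 1 + k%:R * 'X = 1%:P + (k%:R : int) *: 'X.
  by rewrite -mul_polyC rmorph_nat.
by apply: log_concave_linear => //; rewrite ler0n.
Qed.

Lemma log_concave_pa : log_concave pa.
Proof. exact: (log_concave_natX 2). Qed.

Lemma log_concave_pG : log_concave pG.
Proof.
apply: log_concaveM; [exact: log_concave_pb | exact: (log_concave_natX 3)].
Qed.

Lemma log_concave_pA : log_concave pA.
Proof.
have -> : pA = Poly [:: 1; 9; 28; 36; 17; 1].
  by rewrite /pA /= !cons_poly_def !rmorph_nat /=; ring.
apply: (@log_concave_local _ 5) => i.
- by case: i => [|[|[|[|[|[|i]]]]]] // _; rewrite coef_Poly.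
- by move=> lt_i; rewrite coef_Poly nth_default.
- by case: i => [|[|[|[|i]]]] // _; rewrite !coef_Poly.
Qed.

(* The branch at v2: its root joined to one end of each of m disjoint edges. *)
Definition pB m : {poly int} := pa ^+ m + 'X * pb ^+ m.

Lemma coef_pbX M k : (pb ^+ M)`_k = 'C(M, k)%:Z.
Proof.
elim: M k => [|M IHM] k.
  by rewrite expr0 coef1 bin0n; case: k.
rewrite exprS mulrDl mul1r coefD coefXM.
case: k => [|k] /=; first by rewrite addr0 IHM !bin0.
by rewrite !IHM binS PoszD.
Qed.

Lemma coef_pB m k :
  (pB m)`_k = 'C(m, k)%:Z * 2 ^+ k + (if k is k'.+1 then 'C(m, k')%:Z else 0).
Proof. by rewrite /pB coefD coef_paX coefXM; case: k => [|k] //=; rewrite coef_pbX. Qed.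

Lemma log_concave_pB m : log_concave (pB m).
Proof.
apply: (@log_concave_local _ m.+1) => k; rewrite !coef_pB.
- case: k => [|k] le_k; first by rewrite bin0.
  by rewrite ltr_wpDl ?mulr_ge0 ?exprn_ge0 // ltz_nat bin_gt0.
- by case: k => // k lt_k; rewrite !bin_small ?mul0r //; lia.
rewrite ltnS => lt_km; have [_ lc_pb] := log_concaveX m log_concave_pb.
set c0 := (if k is _.+1 then _ else 0).
set c1 := 'C(m, k)%:Z; set c2 := 'C(m, k.+1)%:Z; set c3 := 'C(m, k.+2)%:Z.
have [c03 c02] : c0 * c3 <= c1 * c2 /\ c0 * c2 <= c1 * c1.
  rewrite /c0 /c1 /c2 /c3; case: k {lt_km c0 c1 c2 c3} => [|k].
    by rewrite !mul0r; split; rewrite mulr_ge0.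
  by split; rewrite -!coef_pbX; apply: lc_pb; lia.
have c1_ge0 : 0 <= c1 by []. have c2_ge0 : 0 <= c2 by [].
have Tk : k.+1%:Z <= 2 ^+ k by rewrite -(natrX _ 2) natz lez_nat ltn_expl.
have T_gt0 : 0 < (2 : int) ^+ k by rewrite exprn_gt0.
have r2 : k.+1%:Z * c2 = (m%:Z - k%:Z) * c1.
  by rewrite /c1 /c2 subzn 1?ltnW // -!PoszM mul_bin_left.
have r3 : k.+2%:Z * c3 = (m%:Z - k%:Z - 1) * c2.
  have -> : m%:Z - k%:Z - 1 = (m - k.+1)%N by lia.
  by rewrite /c3 /c2 -!PoszM mul_bin_left.
rewrite !exprS; move: (2 ^+ k) Tk T_gt0 => T Tk T_gt0.
(* With T = 2^k the three coefficients are T c1 + c0, 2 T c2 + c1 and 4 T c3 + c2. After [c03] and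
   [c02] this is what remains; multiplied by (k + 2)(m - k) it reads (k + 1)(k + 2) c2^2 <= 4 T (m +
   1) c2^2. *)
have key : c1 * c2 <= 4 * T * (c2 * c2 - c1 * c3).
  pose u := m%:Z - k%:Z; have u_gt0 : 0 < u by rewrite /u; lia.
  have ku_gt0 : 0 < k.+2%:Z * u by rewrite mulr_gt0.
  rewrite -(ler_pM2l ku_gt0).
  have -> : k.+2%:Z * u * (c1 * c2) = k.+1%:Z * k.+2%:Z * (c2 * c2).
    transitivity (k.+2%:Z * c2 * (u * c1)); first by ring.
    by rewrite -r2; ring.
  have -> : k.+2%:Z * u * (4 * T * (c2 * c2 - c1 * c3)) =
            4 * T * (m%:Z + 1) * (c2 * c2).
    transitivity (4 * T * (k.+2%:Z * u * (c2 * c2) - (u * c1) * (k.+2%:Z * c3))).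
      by ring.
    rewrite -r2 r3 /u; have -> : k.+2%:Z = k%:Z + 2 by lia.
    have -> : k.+1%:Z = k%:Z + 1 by lia.
    by ring.
  rewrite ler_wpM2r ?mulr_ge0 //.
  apply: ler_pM => //; first by lia.
  by lia.
nia.
Qed.

Lemma log_concave_pAb_pa M : log_concave (pA * pb * pa ^+ M).
Proof.
apply: log_concaveM (log_concaveX _ log_concave_pa).
exact: log_concaveM log_concave_pA log_concave_pb.
Qed.

(* The mode is at p + 2 or p + 3. *)
Record mode_bounds (N p : nat) : Prop := ModeBounds {
  mode_pos : 0 < dcoef p.+2 (pA * pa ^+ N);
  mode_low : forall M,
    0 < 4 * dcoef p.+1 (pA * pb * pa ^+ M) + dcoef p.+2 (pA * pa ^+ N);
  mode_neg : dcoef p.+4 (pA * pa ^+ N) < 0;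
  mode_up1 : forall M, (M < N)%N -> dcoef p.+3 (pA * pb * pa ^+ M) <= 0;
  mode_up2 : forall M, (M < N)%N ->
    dcoef p.+2 (pA * pb * pa ^+ M) + dcoef p.+4 (pA * pa ^+ N) < 0;
  mode_Gpos : 0 < dcoef p.+1 (pG * pa ^+ (N + 2));
  mode_Gneg : dcoef p.+3 (pG * pa ^+ (N + 2)) < 0
}.

(** Finitely many tests give bounds for all M: [dcoef_min] reduces [mode_low] to M = N - q, and
    monotonicity in M reduces the upper bounds to M = N - 1. *)
Lemma check_mode_bounds N0 N1 p0 p1 q (r : nat) :
    (0 < N0)%N -> (0 < p0)%N -> (q <= N0)%N ->
    check_mode N0 N1 p0.+2 p1 q ->
  mode_bounds (N0 + N1 * r) (p0 + p1 * r).
Proof.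
move=> N0_gt0 p0_gt0 le_qN; rewrite /check_mode.
have [-> -> ->] : [/\ p0.+2 - 1 = p0.+1, p0.+2 - 2 = p0 & p0.+2 + 2 = p0.+4]%N.
  by split; lia.
have -> : (p0.+2 + 1 = p0.+3)%N by lia.
case/and5P=> /(check_signP r) W /(check_sign2P r) mix Um /(check_signP r) Up.
case/and5P=> /(check_signP r) W' /(check_signP r) V' /(check_sign2P r) mix'.
move=> /(check_signP r) G1 /(check_signP r) G2; move: W mix Up W' V' mix' G1 G2.
rewrite !(mapK Z_of_intK) !addSn -!dcoef_pA -!dcoef_pAb -!dcoef_pG.
rewrite (addnAC N0 2); set N := (N0 + N1 * r)%N; set p := (p0 + p1 * r)%N.
have -> : (N0 - 1 + N1 * r = N.-1)%N by lia.
have -> : int_of_Z 1 = 1 by []. have -> : int_of_Z (-1) = -1 by [].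
have -> : int_of_Z 4 = 4 by [].
rewrite !mul1r !mulN1r !oppr_gt0 => W mix Up W' V' mix' G1 G2.
have p_eq : p = p.-1.+1 by rewrite /p; lia.
have lcAb := log_concave_pAb_pa.
split=> // [M|M lt_MN|M lt_MN].
- apply: lt_le_trans mix _; rewrite lerD2r ler_pM2l //.
  (* The increment at degree [p] turns positive at exponent N - q: either the preceding one is
     negative or N - q is 0. *)
  rewrite p_eq in Up *; apply: dcoef_min => //.
  case/orP: Um => [/andP[/eqP N0q /eqP N10]|/andP[lt_qN /(check_signP r)]].
    by left; rewrite N0q N10 subnn.
  rewrite (mapK Z_of_intK) -dcoef_pAb -/p p_eq => Um; right.
  exists (N0 - q.+1 + N1 * r)%N; first by lia.
  by apply: ltW; move: Um; rewrite mulN1r oppr_gt0.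
- rewrite leNgt; apply/negP => /(dcoef_gt0_mono lcAb (_ : M <= N.-1)%N).
  by move=> /(_ ltac:(lia)); lia.
case: (lerP (dcoef p.+2 (pA * pb * pa ^+ M)) 0) => [le0|gt0].
  by apply: le_lt_trans W'; rewrite gerDr.
apply: le_lt_trans mix'; rewrite lerD2r.
by apply: dcoef_max gt0 => //; lia.
Qed.

(** The witness is p = floor(2N/3) + 1, affine in r on each residue class modulo 3. For N < 5 the
    slopes are 0 and the minimising exponent is 0, so q = N. *)
Lemma mode_bounds_exist N : (2 <= N)%N -> exists p, mode_bounds N p.
Proof.
case: (ltnP N 5) => [lt_N|le_N] ge2.
  have [|[|]] : N = 2 \/ N = 3 \/ N = 4 by lia.
  - by move=> ->; exists (2 + 0 * 0)%N; apply: (@check_mode_bounds 2 0 2 0 2 0); vm_compute.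
  - by move=> ->; exists (3 + 0 * 0)%N; apply: (@check_mode_bounds 3 0 3 0 3 0); vm_compute.
  - by move=> ->; exists (3 + 0 * 0)%N; apply: (@check_mode_bounds 4 0 3 0 4 0); vm_compute.
pose r := ((N - 5) %/ 3)%N.
have [|[|]] : N = (5 + 3 * r)%N \/ N = (6 + 3 * r)%N \/ N = (7 + 3 * r)%N.
  by rewrite /r; lia.
- by move=> ->; exists (4 + 2 * r)%N; apply: (@check_mode_bounds _ _ _ _ 4); vm_compute.
- by move=> ->; exists (5 + 2 * r)%N; apply: (@check_mode_bounds _ _ _ _ 4); vm_compute.
- by move=> ->; exists (5 + 2 * r)%N; apply: (@check_mode_bounds _ _ _ _ 5); vm_compute.
Qed.

Definition pF m n : {poly int} := pA * pB m * pB n.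

(** One factor b is pulled out of each mixed term, leaving total exponent m + n + 1, one less than
    the full exponent. *)
Lemma pF_expand m n :
  pF m.+1 n.+1 = pA * pa ^+ (m.+1 + n.+1) +
    ('X * (pA * pb * (pa ^+ m.+1 * pb ^+ n)) +
    ('X * (pA * pb * (pa ^+ n.+1 * pb ^+ m)) +
     'X * ('X * (pA * pb * (pa ^+ 0 * pb ^+ (m.+1 + n)))))).
Proof. by rewrite /pF /pB !exprD !exprS expr0; ring. Qed.

Lemma pF_mode m n p : (0 < m)%N -> (0 < n)%N -> mode_bounds (m + n) p ->
  0 < dcoef p.+2 (pF m n) /\ dcoef p.+4 (pF m n) < 0.
Proof.
case: m n => [|m] [|n] // _ _ [W low W' up1 up2 _ _].
set N := (m.+1 + n.+1)%N in W low W' up1 up2.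
pose h M := pA * pb * pa ^+ M.
have lcAb := log_concave_pAb_pa.
(* If the increment at [p] is negative, the one at [p.+1] is nonpositive, so [dcoef_succ] bounds
   twice the former below by the increment at [p.+1] for exponent M + 1. *)
have low2 M : 0 <= 8 * dcoef p (h M) + dcoef p.+2 (pA * pa ^+ N).
  case: (lerP 0 (dcoef p (h M))) => [|lt0]; first by lia.
  have le0 : dcoef p.+1 (h M) <= 0 := dcoef_lt0_up (lcAb M) lt0 (leqnSn p).
  have := low M.+1; have := dcoef_succ (pA * pb) p M.
  rewrite -/(h M) -/(h M.+1); lia.
rewrite pF_expand !dcoefD !dcoefXM; split.
  have low1' i j : (i + j < N)%N ->
      0 <= 4 * dcoef p.+1 (pA * pb * (pa ^+ i * pb ^+ j)) + dcoef p.+2 (pA * pa ^+ N).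
    move=> lt_ij; rewrite -lerBlDr sub0r.
    apply: (@average_pa_pb (fun P => 4 * dcoef p.+1 P) _ _ N) => [P R|M _|].
    - by rewrite dcoefD mulrDr.
    - by rewrite -subr_ge0 opprK; apply: ltW.
    - exact: ltnW.
  have low2' i j : (i + j < N)%N ->
      0 <= 8 * dcoef p (pA * pb * (pa ^+ i * pb ^+ j)) + dcoef p.+2 (pA * pa ^+ N).
    move=> lt_ij; rewrite -lerBlDr sub0r.
    apply: (@average_pa_pb (fun P => 8 * dcoef p P) _ _ N) => [P R|M _|].
    - by rewrite dcoefD mulrDr.
    - by rewrite -subr_ge0 opprK; apply: low2.
    - exact: ltnW.
  (* The losses are at most 1/4, 1/4 and 1/8 of the positive leading increment. *)
  have := low1' m.+1 n; have := low1' n.+1 m; have := low2' 0%N (m.+1 + n)%N.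
  rewrite -/N; lia.
have up1' i j : (i + j < N)%N -> dcoef p.+3 (pA * pb * (pa ^+ i * pb ^+ j)) <= 0.
  move=> lt_ij; rewrite -oppr_ge0.
  apply: (@average_pa_pb (fun P => - dcoef p.+3 P) _ _ N.-1) => [P R|M le_M|].
  - by rewrite dcoefD opprD.
  - by rewrite oppr_ge0 up1 //; lia.
  - by lia.
(* The 1 turns a strict integer inequality into the weak one that averaging preserves. *)
have up2' i j : (i + j < N)%N ->
    dcoef p.+4 (pA * pa ^+ N) + 1 <= - dcoef p.+2 (pA * pb * (pa ^+ i * pb ^+ j)).
  move=> lt_ij.
  apply: (@average_pa_pb (fun P => - dcoef p.+2 P) _ _ N.-1) => [P R|M le_M|].
  - by rewrite dcoefD opprD.
  - by have := up2 M; lia.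
  - by lia.
have := up1' m.+1 n; have := up1' n.+1 m; have := up2' 0%N (m.+1 + n)%N.
rewrite -/N; lia.
Qed.

(** Both sequences rise up to [p] and fall from [p.+1] on, so only the comparison of the sums at [p]
    and [p.+1] is open; either outcome gives a mode. *)
Lemma unimodal_sum_log_concave P Q p : log_concave P -> log_concave Q ->
    0 < dcoef p P -> 0 < dcoef p Q -> dcoef p.+2 P < 0 -> dcoef p.+2 Q < 0 ->
  unimodal_poly (P + Q).
Proof.
move=> lcP lcQ P_up Q_up P_dn Q_dn.
have up i : (i < p)%N -> (P + Q)`_i <= (P + Q)`_i.+1.
  move=> lt_ip; rewrite -subr_ge0 -dcoefS dcoefD.
  by rewrite addr_ge0 // (dcoef_gt0_down _ _ lt_ip).
have dn i : (p < i)%N -> (P + Q)`_i.+1 <= (P + Q)`_i.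
  move=> lt_pi; rewrite -subr_le0 -dcoefS dcoefD.
  have dn R : log_concave R -> dcoef p.+2 R < 0 -> dcoef i.+1 R <= 0.
    by move=> lcR /(dcoef_lt0_up lcR); apply.
  by have := dn P lcP P_dn; have := dn Q lcQ Q_dn; lia.
case: (lerP (P + Q)`_p (P + Q)`_p.+1) => [le_p|/ltW ge_p].
  exists p.+1; split=> i; last by move=> lt_pi _; apply: dn.
  by rewrite ltnS leq_eqVlt => /predU1P[->|/up].
exists p; split=> // i; rewrite leq_eqVlt => /predU1P[<-|/dn] //.
Qed.

Lemma unimodal_tstar_poly m n : (0 < m)%N -> (0 < n)%N ->
  unimodal_poly (pF m n + 'X * (pG * pa ^+ (m + n + 2))).
Proof.
move=> m_gt0 n_gt0; have [|p bounds] := @mode_bounds_exist (m + n); first by lia.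
have [F_up F_dn] := pF_mode m_gt0 n_gt0 bounds.
have lcX : log_concave 'X.
  have := @log_concave_linear 0 1; rewrite scale1r polyC0 add0r; exact.
apply: (@unimodal_sum_log_concave _ _ p.+2) => //.
- apply: log_concaveM (log_concave_pB n).
  exact: log_concaveM log_concave_pA (log_concave_pB m).
- apply: log_concaveM lcX _.
  exact: log_concaveM log_concave_pG (log_concaveX _ log_concave_pa).
- by rewrite dcoefXM; apply: mode_Gpos bounds.
- by rewrite dcoefXM; apply: mode_Gneg bounds.
Qed.

(** * Independence polynomials by vertex elimination *)

Lemma indep_poly_sum (T : finType) (e : rel T) :
  indep_poly e = \sum_(S : {set T} | independent e S) 'X^#|S|.
Proof.
apply/polyP => k; rewrite coef_poly coef_sum.
under eq_bigr do rewrite coefXn mulrb.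
have -> : \sum_(S | independent e S) (if k == #|S| then 1 else 0) = (indep_count e k)%:Z.
  rewrite -big_mkcondr /= sumr_const -natz; congr (_ *+ _).
  by apply: eq_card => S; rewrite !inE eq_sym.
case: ltnP => // lt_Tk; apply/esym/eqP; rewrite eqz_nat cards_eq0.
apply/eqP/setP => S; rewrite !inE; apply/negP => /andP[_ /eqP eS].
by have := max_card (mem S); rewrite eS leqNgt lt_Tk.
Qed.

(* Weighted count of the independent subsets of s none of whose elements is
   adjacent to an element of c. *)
Fixpoint avoid_poly (T : Type) (e : rel T) (s c : seq T) : {poly int} :=
  if s is v :: s' then
    avoid_poly e s' c +
    (if has (e v) c then 0 else 'X * avoid_poly e s' (v :: c))
  else 1.

Section AvoidPoly.
Variables (T : eqType) (e : rel T).

Definition nonadj (s t : seq T) : Prop :=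
  forall x y, x \in s -> y \in t -> e x y = false.

(** The vertex [v] may sit inside the list because the recursion pushes vertices in front of it. *)
Lemma avoid_poly_cons_nonadj s v c d :
    (forall x, x \in s -> e x v = false) ->
  avoid_poly e s (c ++ v :: d) = avoid_poly e s (c ++ d).
Proof.
elim: s c => [|u s IHs] c nadj //=; rewrite !has_cat /= nadj ?mem_head //=.
by rewrite IHs ?(IHs (u :: c)) // => x xs; rewrite nadj // inE xs orbT.
Qed.

Lemma avoid_poly_nonadj s v c : (forall x, x \in s -> e x v = false) ->
  avoid_poly e s (v :: c) = avoid_poly e s c.
Proof. exact: (@avoid_poly_cons_nonadj s v [::]). Qed.

(** Vertices chosen from [s] join the avoided list but do not constrain [t]. *)
Lemma avoid_poly_cat s t c : nonadj t s ->
  avoid_poly e (s ++ t) c = avoid_poly e s c * avoid_poly e t c.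
Proof.
elim: s c => [|v s IHs] c nadj /=; first by rewrite mul1r.
have nadj' : nonadj t s by move=> x y xt ys; rewrite nadj // inE ys orbT.
rewrite !IHs // (@avoid_poly_nonadj t v); last by move=> x xt; rewrite nadj ?mem_head.
by case: ifP => _; ring.
Qed.

Lemma avoid_poly_flatten (I : eqType) (b : I -> seq T) (r : seq I) c q :
    uniq r -> (forall i, i \in r -> avoid_poly e (b i) c = q) ->
    (forall i j, i \in r -> j \in r -> i != j -> nonadj (b i) (b j)) ->
  avoid_poly e (flatten (map b r)) c = q ^+ size r.
Proof.
elim: r => [|i r IHr] //= /andP[i_r uniq_r] bq nadj.
rewrite avoid_poly_cat => [|x y /flattenP[_ /mapP[j jr ->] xb] yb].
  rewrite bq ?mem_head // IHr ?exprS // => [j jr|j k jr kr]; first by rewrite bq // inE jr orbT.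
  by apply: nadj; rewrite inE ?jr ?kr orbT.
apply: nadj xb yb; rewrite ?mem_head ?inE ?jr ?orbT //.
by apply: contraNneq i_r => <-.
Qed.

End AvoidPoly.

Lemma avoid_poly_map (T U : Type) (f : T -> U) (e : rel T) (e' : rel U) s c :
    (forall x y, e x y = e' (f x) (f y)) ->
  avoid_poly e s c = avoid_poly e' (map f s) (map f c).
Proof.
move=> ee'; elim: s c => [|v s IHs] c //=; rewrite IHs (IHs (v :: c)) has_map.
by rewrite (@eq_has _ (e v) (preim f (e' (f v)))).
Qed.

Section AvoidPolySet.
Variables (T : finType) (e : rel T).
Hypotheses (e_sym : symmetric e) (e_irr : irreflexive e).

Let ok (s c : seq T) (S : {set T}) :=
  [&& independent e S, S \subset s & [forall x in S, ~~ has (e x) c]].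

Let ok_setU1 v s c (S : {set T}) : v \notin S ->
  ok (v :: s) c (v |: S) = ~~ has (e v) c && ok s (v :: c) S.
Proof.
move=> vS; apply/and3P/and4P.
  case=> /forall_inP indS /subsetP subS /forall_inP avS; split.
  - by apply: avS; rewrite setU11.
  - apply/forall_inP => x xS; apply/forall_inP => y yS.
    by apply: (forall_inP (indS x _)); rewrite setU1r.
  - apply/subsetP => x xS; have := subS x (setU1r v xS); rewrite inE.
    by case/predU1P=> // xv; rewrite -xv xS in vS.
  - apply/forall_inP => x xS /=; rewrite negb_or (avS x (setU1r v xS)) andbT.
    by apply: (forall_inP (indS x (setU1r v xS))); rewrite setU11.
case=> avv /forall_inP indS /subsetP subS /forall_inP avS.
have avS' x : x \in S -> ~~ e x v /\ ~~ has (e x) c.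
  by move=> /avS /=; rewrite negb_or => /andP.
split.
- apply/forall_inP => x /setU1P[->|xS]; apply/forall_inP => y /setU1P[->|yS].
  + by rewrite e_irr.
  + by rewrite e_sym; have [] := avS' y yS.
  + by have [] := avS' x xS.
  + exact: (forall_inP (indS x xS)).
- by apply/subsetP => x /setU1P[->|/subS xs]; rewrite inE ?eqxx // xs orbT.
- by apply/forall_inP => x /setU1P[->|/avS'[]].
Qed.

(** Sets are split by whether they contain the head [v]; those that do are [v |: S] with [S]
    avoiding the neighbours of [v]. *)
Lemma avoid_polyE s c : uniq s ->
  \sum_(S : {set T} | ok s c S) 'X^#|S| = avoid_poly e s c.
Proof.
elim: s c => [|v s IHs] c /=.
  rewrite (big_pred1 set0) ?cards0 // => S /=.
  apply/and3P/eqP => [[_ /subsetP subS _]|->].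
    by apply/setP => x; rewrite inE; apply/negP => /subS.
  split; first by apply/forall_inP => x; rewrite inE.
    by apply/subsetP => x; rewrite inE.
  by apply/forall_inP => x; rewrite inE.
case/andP=> vs uniq_s; rewrite (bigID (fun S : {set T} => v \in S)) /= addrC.
congr (_ + _).
  rewrite -IHs //; apply: eq_bigl => S.
  have -> : ok s c S = ok (v :: s) c S && (v \notin S); last by [].
  rewrite /ok; have -> : (S \subset s) = (S \subset v :: s) && (v \notin S).
    apply/subsetP/andP => [subS|[/subsetP subS vS] x xS].
      split; last by apply: contra vs => /subS.
      by apply/subsetP => x /subS xs; rewrite inE xs orbT.
    by have := subS x xS; rewrite inE => /predU1P[xv|//]; rewrite -xv xS in vS.
  by rewrite -!andbA [(v \notin S) && _]andbC.
rewrite (reindex_onto (fun S => v |: S) (fun S => S :\ v)) /=; last first.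
  by move=> S /andP[_ vS]; rewrite setD1K.
have cond S : [&& ok (v :: s) c (v |: S), v \in v |: S & (v |: S) :\ v == S] =
              ~~ has (e v) c && ok s (v :: c) S.
  rewrite setU11 /=; case: (boolP (v \in S)) => vS.
    have -> : ((v |: S) :\ v == S) = false.
      by apply/eqP => /setP/(_ v); rewrite !inE eqxx vS.
    apply/esym/negP; rewrite andbF => /andP[_ /and3P[_ /subsetP/(_ v vS) vs']].
    by rewrite vs' in vs.
  by rewrite setU1K // eqxx andbT ok_setU1.
rewrite (eq_bigl _ _ (fun S => etrans (esym (andbA _ _ _)) (cond S))).
case: ifP => av; first by rewrite big_pred0.
rewrite -IHs // mulr_sumr; apply: eq_bigr => S.
case/and4P=> _ _ /subsetP subS _.
by rewrite cardsU1 (contra (subS v)) // exprS.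
Qed.

Lemma indep_poly_avoid s : uniq s -> (forall x, x \in s) ->
  indep_poly e = avoid_poly e s [::].
Proof.
move=> uniq_s all_s; rewrite indep_poly_sum -avoid_polyE //.
apply: eq_bigl => S; rewrite /ok; case: independent => //=; apply/esym/andP; split.
  by apply/subsetP => x _; apply: all_s.
by apply/forall_inP.
Qed.

End AvoidPolySet.

(** * The tree *)

Section Tree.
Variables m n : nat.
Let c := (3 + m + n)%N.
Let par := tstar_parent m n.
(** Adjacency on plain natural labels, so that label arithmetic needs no ordinals. *)
Let adj : rel nat := fun x y => (x != y) && ((par x == y) || (par y == x)).

Let c_ge3 : (3 <= c)%N.
Proof. by rewrite /c; lia. Qed.

Let par_top k : (k <= 3)%N -> par k = 0%N.
Proof. by rewrite /par /tstar_parent => ->; case: ifP. Qed.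

Let par_mid g : (g < c)%N ->
  par (4 + g) = if (g < 3)%N then 1%N else if (g < 3 + m)%N then 2%N else 3%N.
Proof. by move=> lt_gc; rewrite /par /tstar_parent /= ltn_add2l -/c lt_gc addKn. Qed.

Let par_leaf g : (g < c)%N -> par (4 + c + g) = (4 + g)%N.
Proof.
move=> lt_gc; rewrite /par /tstar_parent -/c.
by do 5?[case: ifP => ?]; lia.
Qed.

Let par_x : par (4 + 2 * c) = (4 + c + 2)%N.
Proof. by rewrite /par /tstar_parent -/c; do 5?[case: ifP => ?]; lia. Qed.

Let par_y : par (5 + 2 * c) = (4 + 2 * c)%N.
Proof. by rewrite /par /tstar_parent -/c; do 5?[case: ifP => ?]; lia. Qed.

Let pair g := [:: 4 + g; 4 + c + g]%N.
Let pairs a b := flatten (map pair (iota a b)).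
(** The path v13, v'13, x, y; v13 has g = 2. *)
Let tail := [:: 6; 6 + c; 4 + 2 * c; 5 + 2 * c]%N.
Let block1 := pairs 0 2 ++ tail.
Let block2 := pairs 3 m.
Let block3 := pairs (3 + m) n.
Let vertices := 0%N :: (1%N :: block1) ++ (2%N :: block2) ++ (3%N :: block3).

Let pairsP x a b : reflect
  (exists2 g, (a <= g < a + b)%N & x = (4 + g)%N \/ x = (4 + c + g)%N)
  (x \in pairs a b).
Proof.
apply: (iffP flattenP) => [[_ /mapP[g ga ->]]|[g ga xg]].
  rewrite !inE => xg; exists g; first by rewrite -mem_iota.
  by case/orP: xg => /eqP; [left|right].
exists (pair g); first by rewrite map_f // mem_iota.
by rewrite !inE; case: xg => ->; rewrite eqxx ?orbT.
Qed.

Let size_pairs a b : size (pairs a b) = (2 * b)%N.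
Proof.
elim: b a => [|b IHb] a //.
by rewrite /pairs /= -/(pairs a.+1 b) IHb; lia.
Qed.

Let mem_vertices k : (k < tstar_size m n)%N -> k \in vertices.
Proof.
rewrite /tstar_size => lt_k.
suff : [|| (k < 4)%N, k \in pairs 0 2, k \in tail, k \in block2 | k \in block3].
  rewrite /vertices /block1.
  move: (pairs 0 2) (tail) (block2) (block3) => s t s2 s3.
  rewrite !(in_cons, mem_cat).
  case/or4P=> [lt4|->|->|/orP[]->]; rewrite ?orbT //.
  have k4 : [|| k == 0, k == 1, k == 2 | k == 3]%N by lia.
  by case/or4P: k4 => ->; rewrite ?orbT.
have pairsI a b g : (a <= g < a + b)%N -> (k == 4 + g)%N || (k == 4 + c + g)%N ->
    k \in pairs a b.
  by move=> ga /orP[] /eqP kg; apply/pairsP; exists g => //; [left|right].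
have in_pairs g : (g < c)%N -> (k == 4 + g)%N || (k == 4 + c + g)%N ->
    [|| k \in pairs 0 2, k \in tail, k \in block2 | k \in block3].
  rewrite {1}/c => lt_gc kg; case: (ltngtP g 2) => [lt2|gt2|eg].
  - by rewrite (pairsI 0%N 2%N g).
  - case: (ltnP g (3 + m)) => cmp.
      by rewrite /block2 (pairsI 3%N m g) ?orbT //; lia.
    by rewrite /block3 (pairsI (3 + m)%N n g) ?orbT //; lia.
  - suff -> : k \in tail by rewrite orbT.
    by rewrite !inE; lia.
case: (ltnP k 4) => [//|le4]; rewrite orFb; case: (ltnP k (4 + c)) => [lt1|le1].
  by apply: (in_pairs (k - 4)%N); lia.
case: (ltnP k (4 + 2 * c)) => [lt2|le2].
  by apply: (in_pairs (k - (4 + c))%N); lia.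
suff -> : k \in tail by rewrite orbT.
by rewrite !inE; lia.
Qed.

Let size_vertices : size vertices = tstar_size m n.
Proof.
have s2 : size block2 = (2 * m)%N := size_pairs 3 m.
have s3 : size block3 = (2 * n)%N := size_pairs (3 + m) n.
by rewrite /= size_cat /= s2 s3 /tstar_size; lia.
Qed.

(** By counting: the list covers all labels and has exactly as many entries. *)
Let uniq_vertices : uniq vertices.
Proof.
apply: (@leq_size_uniq _ (iota 0 (tstar_size m n))); first exact: iota_uniq.
  by move=> k; rewrite mem_iota add0n => /mem_vertices.
by rewrite size_iota size_vertices.
Qed.

Lemma indep_poly_tstar_avoid :
  indep_poly (@tstar_adj m n) = avoid_poly adj vertices [::].
Proof.
pose s : seq 'I_(tstar_size m n) := pmap insub vertices.
(* Every entry is a valid label, so [insub] discards nothing. *)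
have val_s : map val s = vertices.
  rewrite /s pmap_filter; last exact: insubK.
  apply/all_filterP/allP => k; rewrite isSome_insub.
  have [|||_ eq_mem] := @uniq_min_size _ (iota 0 (tstar_size m n)) vertices.
  - exact: iota_uniq.
  - by move=> i; rewrite mem_iota add0n => /mem_vertices.
  - by rewrite size_iota size_vertices.
  by rewrite -eq_mem mem_iota add0n.
rewrite (@indep_poly_avoid _ _ _ _ s).
- by rewrite (@avoid_poly_map _ _ val _ adj) ?val_s.
- by move=> x y; rewrite /tstar_adj eq_sym orbC.
- by move=> x; rewrite /tstar_adj eqxx.
- by rewrite -(map_inj_uniq val_inj) val_s uniq_vertices.
- by move=> x; rewrite -(mem_map val_inj) val_s mem_vertices ?ltn_ord.
Qed.

(** * Separation of the three branches *)

Let mid_branch g : nat := if (g < 3)%N then 1%N else if (g < 3 + m)%N then 2%N else 3%N.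
(** The child of the root whose subtree contains [k]. Below that level it is invariant under taking
    parents, so nonroot vertices of different branches are not adjacent. *)
Let branch k : nat :=
  if (k <= 3)%N then k else if (4 + 2 * c <= k)%N then 1%N
  else mid_branch (if k < 4 + c then k - 4 else k - (4 + c))%N.

Let branch_par k : (3 < k)%N -> branch (par k) = branch k.
Proof.
have c_ge3' := c_ge3; move=> lt_k; rewrite /par /tstar_parent -/c.
do 7?[case: ifP => ?]; rewrite /branch; do 7?[case: ifP => ? //];
  rewrite /mid_branch //=; do 4?[case: ifP => ? //]; lia.
Qed.

Let adj_branch x y : (0 < x)%N -> (0 < y)%N -> branch x != branch y ->
  adj x y = false.
Proof.
move=> x_gt0 y_gt0 neq; apply/negP => /andP[_ /orP[] /eqP E].
  case: (leqP x 3) => [/par_top|/branch_par]; rewrite E; first by lia.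
  by move=> Ebr; rewrite Ebr eqxx in neq.
case: (leqP y 3) => [/par_top|/branch_par]; rewrite E; first by lia.
by move=> Ebr; rewrite Ebr eqxx in neq.
Qed.

Let mid_branchE a b v : (forall g, (a <= g < a + b)%N -> (g < c)%N /\ mid_branch g = v) ->
  forall x, x \in pairs a b -> (3 < x)%N /\ branch x = v.
Proof.
move=> abv x /pairsP[g /abv[lt_gc <-]] [] ->; split; rewrite ?addSn // /branch -!addSn.
  have [-> -> ->] : [/\ (4 + g <= 3) = false, (4 + 2 * c <= 4 + g) = false &
      (4 + g < 4 + c)]%N by split; lia.
  by congr mid_branch; lia.
have [-> -> ->] : [/\ (4 + c + g <= 3) = false, (4 + 2 * c <= 4 + c + g) = false &
    (4 + c + g < 4 + c) = false]%N by split; lia.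
by congr mid_branch; lia.
Qed.

Let branch1 x : x \in block1 -> (3 < x)%N /\ branch x = 1%N.
Proof.
rewrite mem_cat => /orP[|].
  apply: mid_branchE => g lt_g; rewrite /mid_branch /c; case: ifP => ?; lia.
rewrite !inE => /or4P[] /eqP ->; split=> //; rewrite ?addSn // /branch;
  do 3?[case: ifP => ? //]; rewrite /mid_branch; do 3?[case: ifP => ? //]; lia.
Qed.

Let branch2 x : x \in block2 -> (3 < x)%N /\ branch x = 2%N.
Proof.
apply: mid_branchE => g lt_g; rewrite /mid_branch /c.
by do 2?[case: ifP => ?]; lia.
Qed.

Let branch3 x : x \in block3 -> (3 < x)%N /\ branch x = 3%N.
Proof.
apply: mid_branchE => g lt_g; rewrite /mid_branch /c.
by do 2?[case: ifP => ?]; lia.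
Qed.

Let par_mid_bounds g : (g < c)%N -> (0 < par (4 + g) <= 3)%N.
Proof. by move=> /par_mid ->; do 2?[case: ifP]. Qed.

Let adj_leaf g : (g < c)%N -> adj (4 + c + g) (4 + g) = true.
Proof. by move=> lt_gc; have := c_ge3; rewrite /adj par_leaf // eqxx; lia. Qed.

Let nonadj_pair g h : (g < c)%N -> (h < c)%N -> g != h ->
  nonadj adj (pair g) (pair h).
Proof.
move=> lt_gc lt_hc neq_gh x y; have := c_ge3.
have := par_mid_bounds lt_gc; have := par_mid_bounds lt_hc.
rewrite !inE /adj => hb gb c3 /orP[] /eqP -> /orP[] /eqP ->;
  rewrite ?par_leaf //; lia.
Qed.

(** * Polynomials of the blocks *)

Let avoid_pair g : (g < c)%N -> avoid_poly adj (pair g) [::] = pa.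
Proof. by move=> lt_gc; rewrite /= adj_leaf //= /pa; ring. Qed.

(** Once the branch root is chosen, only the leaf of the pair stays available. *)
Let avoid_pair_root g v : (g < c)%N -> (v <= 3)%N -> par (4 + g) = v ->
  avoid_poly adj (pair g) [:: v] = pb.
Proof.
move=> lt_gc le_v par_v.
have adj_v : adj (4 + g) v = true by rewrite /adj par_v eqxx; lia.
have nadj_v : adj (4 + c + g) v = false.
  by rewrite /adj par_leaf // par_top //; lia.
by rewrite /= adj_v nadj_v /= /pb; ring.
Qed.

Let avoid_pairs a b c0 q : (a + b <= c)%N ->
    (forall g, (a <= g < a + b)%N -> avoid_poly adj (pair g) c0 = q) ->
  avoid_poly adj (pairs a b) c0 = q ^+ b.
Proof.
move=> le_abc pq; rewrite (@avoid_poly_flatten _ _ _ _ _ _ q) ?size_iota ?iota_uniq //.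
  by move=> g; rewrite mem_iota; apply: pq.
by move=> g h; rewrite !mem_iota => gab hab; apply: nonadj_pair; lia.
Qed.

Let par6 : par 6 = 1%N.
Proof. by have := @par_mid 2; rewrite /=; apply; have := c_ge3. Qed.

Let par6c : par (6 + c) = 6%N.
Proof.
have -> : (6 + c = 4 + c + 2)%N by lia.
by rewrite par_leaf //; have := c_ge3; lia.
Qed.

Let avoid_tail : avoid_poly adj tail [::] = pG.
Proof.
have c3 := c_ge3; rewrite /tail; set u := 6%N; set v := (6 + c)%N.
set x := (4 + 2 * c)%N; set y := (5 + 2 * c)%N.
have vu : adj v u = true by rewrite /adj par6c eqxx; lia.
have xu : adj x u = false by rewrite /adj par_x par6; lia.
have yu : adj y u = false by rewrite /adj par_y par6; lia.
have xv : adj x v = true by rewrite /adj par_x par6c; lia.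
have yv : adj y v = false by rewrite /adj par_y par6c; lia.
have yx : adj y x = true by rewrite /adj par_y eqxx; lia.
by rewrite /= !(vu, xu, yu, xv, yv, yx) /= /pG; ring.
Qed.

(** With v1 chosen, v13 is excluded and the path v'13, x, y remains. *)
Let avoid_tail_root : avoid_poly adj tail [:: 1%N] = 1 + 3 * 'X + 'X^2.
Proof.
have c3 := c_ge3; rewrite /tail; set u := 6%N; set v := (6 + c)%N.
set x := (4 + 2 * c)%N; set y := (5 + 2 * c)%N.
have xv : adj x v = true by rewrite /adj par_x par6c; lia.
have yv : adj y v = false by rewrite /adj par_y par6c; lia.
have yx : adj y x = true by rewrite /adj par_y eqxx; lia.
have u1 : adj u 1 = true by rewrite /adj par6.
have v1 : adj v 1 = false by rewrite /adj par6c par_top //; lia.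
have x1 : adj x 1 = false by rewrite /adj par_x par_top //; lia.
have y1 : adj y 1 = false by rewrite /adj par_y par_top //; lia.
by rewrite /= !(xv, yv, yx, u1, v1, x1, y1) /=; ring.
Qed.

Let tail_pairs : nonadj adj tail (pairs 0 2).
Proof.
move=> x y xt /pairsP[g lt_g yg]; have c3 := c_ge3.
rewrite !inE in xt; have lt_gc : (g < c)%N by lia.
have := par_mid_bounds lt_gc; rewrite /adj.
case/or4P: xt => /eqP ->; case: yg => -> gb;
  rewrite ?par6 ?par6c ?par_x ?par_y ?par_leaf //; lia.
Qed.

Let avoid_block1 : avoid_poly adj block1 [::] = pG * pa ^+ 2.
Proof.
have c3 := c_ge3; rewrite avoid_poly_cat // avoid_tail mulrC; congr (_ * _).
by apply: avoid_pairs => [|g lt_g]; [lia | apply: avoid_pair; lia].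
Qed.

Let avoid_block1_root :
  avoid_poly adj block1 [:: 1%N] = (1 + 3 * 'X + 'X^2) * pb ^+ 2.
Proof.
have c3 := c_ge3; rewrite avoid_poly_cat // avoid_tail_root mulrC; congr (_ * _).
apply: avoid_pairs => [|g lt_g]; [lia | apply: avoid_pair_root => //; first by lia].
by rewrite par_mid ?ifT; lia.
Qed.

Let avoid_block2 : avoid_poly adj block2 [::] = pa ^+ m.
Proof.
apply: avoid_pairs => [|g lt_g]; first by rewrite /c; lia.
by apply: avoid_pair; rewrite /c; lia.
Qed.

Let avoid_block2_root : avoid_poly adj block2 [:: 2%N] = pb ^+ m.
Proof.
apply: avoid_pairs => [|g lt_g]; first by rewrite /c; lia.
have lt_gc : (g < c)%N by rewrite /c; lia.
by apply: avoid_pair_root => //; rewrite par_mid // ifN ?ifT //; lia.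
Qed.

Let avoid_block3 : avoid_poly adj block3 [::] = pa ^+ n.
Proof.
apply: avoid_pairs => [|g lt_g]; first by rewrite /c; lia.
by apply: avoid_pair; rewrite /c; lia.
Qed.

Let avoid_block3_root : avoid_poly adj block3 [:: 3%N] = pb ^+ n.
Proof.
apply: avoid_pairs => [|g lt_g]; first by rewrite /c; lia.
have lt_gc : (g < c)%N by rewrite /c; lia.
by apply: avoid_pair_root => //; rewrite par_mid // !ifN //; lia.
Qed.

(** Choosing the root excludes its child [v] and constrains nothing deeper. *)
Let avoid_cons_root v s : (0 < v <= 3)%N ->
    (forall x, x \in s -> (3 < x)%N /\ branch x = v) ->
  avoid_poly adj (v :: s) [:: 0%N] = avoid_poly adj s [::].
Proof.
move=> lt_v br; have v0 : adj v 0 = true by rewrite /adj par_top //; lia.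
rewrite /= v0 /= addr0 avoid_poly_nonadj // => x xs.
have [lt_x brx] := br x xs; have := branch_par lt_x; rewrite brx /adj (@par_top 0) //.
by case: (par x =P 0%N) => [->|par_x0 _]; rewrite /branch /=; lia.
Qed.

Let branch_cons v s : (0 < v <= 3)%N ->
    (forall x, x \in s -> (3 < x)%N /\ branch x = v) ->
  forall x, x \in v :: s -> (0 < x)%N /\ branch x = v.
Proof.
move=> /andP[v_gt0 le_v] br x; rewrite inE => /predU1P[->|/br[lt_x ->]].
  by rewrite /branch le_v.
by split=> //; lia.
Qed.

Lemma indep_poly_tstar :
  indep_poly (@tstar_adj m n) = pF m n + 'X * (pG * pa ^+ (m + n + 2)).
Proof.
rewrite indep_poly_tstar_avoid.
have br1 := @branch_cons 1 block1 isT branch1; have br2 := @branch_cons 2 block2 isT branch2.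
have br3 := @branch_cons 3 block3 isT branch3.
have split c0 : avoid_poly adj ((1%N :: block1) ++ (2%N :: block2) ++ (3%N :: block3)) c0 =
    avoid_poly adj (1%N :: block1) c0 * (avoid_poly adj (2%N :: block2) c0 *
      avoid_poly adj (3%N :: block3) c0).
  rewrite !avoid_poly_cat // => x y.
    by move=> /br3[x_gt0 brx] /br2[y_gt0 bry]; rewrite adj_branch // brx bry.
  rewrite mem_cat => /orP[/br2|/br3] [x_gt0 brx] /br1[y_gt0 bry];
    by rewrite adj_branch // brx bry.
have -> : avoid_poly adj vertices [::] =
    avoid_poly adj ((1%N :: block1) ++ (2%N :: block2) ++ (3%N :: block3)) [::] +
    'X * avoid_poly adj ((1%N :: block1) ++ (2%N :: block2) ++ (3%N :: block3)) [:: 0%N].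
  by [].
rewrite !split (@avoid_cons_root 1 block1 isT branch1) (@avoid_cons_root 2 block2 isT branch2).
rewrite (@avoid_cons_root 3 block3 isT branch3).
have cons v s : avoid_poly adj (v :: s) [::] =
    avoid_poly adj s [::] + 'X * avoid_poly adj s [:: v] by [].
rewrite (cons 1%N block1) (cons 2%N block2) (cons 3%N block3).
rewrite avoid_block1 avoid_block2 avoid_block3.
rewrite avoid_block1_root avoid_block2_root avoid_block3_root.
(* The branch at v1, split by whether v1 is chosen. *)
have -> : pG * pa ^+ 2 + 'X * ((1 + 3 * 'X + 'X^2) * pb ^+ 2) = pA.
  by rewrite /pG /pa /pb /pA; ring.
by rewrite /pF /pB !exprD; ring.
Qed.

End Tree.

Theorem mainTheorem2 (m n : nat) :
  (1 <= m)%N -> (1 <= n)%N -> unimodal_poly (indep_poly (@tstar_adj m n)).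
Proof.
by move=> m_gt0 n_gt0; rewrite indep_poly_tstar; apply: unimodal_tstar_poly.
Qed.
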